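(* Let $S_t=\bar H_t=(L_0,A_0,L_1,\dots,A_{t-1},L_t)$ be the full observed history, let $d$ be a regime and $\mathcal Q$ a family of feasible transition sets. Suppose sequential exchangeability and positivity hold at every history–action cell relevant under $d$, so that for every $t=0,\dots,T-1$ and every history $\bar h_t$ that can be reached under $d$, $$\mathcal Q_t(\bar h_t,d_t(\bar h_t))=\{P(L_{t+1}\in\cdot\mid \bar H_t=\bar h_t,\ A_t=d_t(\bar h_t))\},$$ and suppose the root set is the default one, $\mathcal Q_{-1}( *,\star)=\{P(L_0\in\cdot)\}$. Then $$\bar\theta^d=\underline\theta^d=V^d=\sum_{\bar\ell_T}y(\bar\ell_T)\,P(l_0)\prod_{t=0}^{T-1}P(l_{t+1}\mid\bar\ell_t,\bar a_t),$$ where $\bar\ell_t=(l_0,\dots,l_t)$, $\bar a_t=(a_0,\dots,a_t)$ with $a_k=d_k(\bar h_k)$, $\bar h_k=(l_0,a_0,l_1,\dots,a_{k-1},l_k)$, $y(\bar\ell_T)$ denotes $y(\bar h_T)$, and $P(l_{t+1}\mid\bar\ell_t,\bar a_t)=P(L_{t+1}=l_{t+1}\mid \bar H_t=\bar h_t,A_t=a_t)$.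
   Context: **Spaces.** $T\ge1$; $\mathcal S_t$ (here the finite set of possible histories $\bar h_t$), $\mathcal A$, $\mathcal Y\subseteq\mathbb R$ are finite; $Y=y(S_T)$ with $y:\mathcal S_T\to\mathcal Y$ known. A regime is $d=(d_0,\dots,d_{T-1})$, $d_t:\mathcal S_t\to\mathcal A$. **Model.** A structural causal model (SCM) $M$ has mutually independent exogenous variables $\varepsilon_0^S$, $\varepsilon_t^U,\varepsilon_t^A,\varepsilon_{t+1}^S$ ($0\le t\le T-1$) and equations $S_0=f_0^S(\varepsilon_0^S)$, $U_t=f_t^U(\varepsilon_t^U)$, $A_t=f_t^A(S_t,U_t,\varepsilon_t^A)$, $S_{t+1}=f_{t+1}^S(S_t,A_t,U_t,\varepsilon_{t+1}^S)$. Its kernel is $\kappa_{M,t}(\cdot\mid s,a)=$ law of $f_{t+1}^S(s,a,U_t,\varepsilon_{t+1}^S)$. Fixed nonempty sets $\mathcal S_{t+1}(s,a)\subseteq\mathcal S_{t+1}$ contain all values of $f_{t+1}^S(s,a,\cdot,\cdot)$; in the full-history formulation $\mathcal S_{t+1}(\bar h_t,a)$ contains only histories $(\bar h_t,a,l_{t+1})$ extending $(\bar h_t,a)$, so a distribution on it is identified with a distribution of $L_{t+1}$. A graph $G$ specifies at which steps a bidirected edge $A_t\leftrightarrow S_{t+1}$ is present; where absent, $U_t$ may not enter both the $A_t$- and $S_{t+1}$-equations. The data come from a fixed true SCM $M^\star$ satisfying these requirements, with observational law $P$; $\kappa_t=\kappa_{M^\star,t}$. Intervening by $d$ replaces the equation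 for $A_t$ by $A_t=d_t(S_t)$ and leaves all other equations unchanged (modularity); $P^d$ is the resulting law of the trajectory under $M^\star$, and $V^d=\mathbb E[Y^d]=\mathbb E^{P^d}[Y]$. **Root convention.** $\mathcal S_{-1}=\{*\}$, $\mathcal A_{-1}=\{\star\}$, $d_{-1}( * )=\star$, $\mathcal S_0( *,\star)=\mathcal S_0$, $\kappa_{-1}(\cdot\mid*,\star)=P(S_0\in\cdot)$ (here $S_0=L_0$); $\mathcal A_t=\mathcal A$ for $t\ge0$. **Feasible sets and bounds.** A family of feasible transition sets $\mathcal Q=\{\mathcal Q_t(s,a):t=-1,\dots,T-1,s\in\mathcal S_t,a\in\mathcal A_t\}$ consists of nonempty compact convex sets $\mathcal Q_t(s,a)\subseteq\Delta(\mathcal S_{t+1}(s,a))$ (probability distributions) with $\kappa_t(\cdot\mid s,a)\in\mathcal Q_t(s,a)$. $\mathcal P^d(\mathcal Q)$ is the set of trajectory laws $Q(\mathbf v)=q_{-1}(s_0\mid*,\star)\prod_{t=0}^{T-1}\mathbf 1\{a_t=d_t(s_t)\}q_t(s_{t+1}\mid s_t,a_t)$ with $q_t(\cdot\mid s,d_t(s))\in\mathcal Q_t(s,d_t(s))$ for all $t=-1,\dots,T-1$, $s\in\mathcal S_t$. $\bar\theta^d=\sup_{Q\in\mathcal P^d(\mathcal Q)}\mathbb E^Q[Y]$, $\underline\theta^d=\inf_{Q\in\mathcal P^d(\mathcal Q)}\mathbb E^Q[Y]$. **Exchangeability, positivity, reachability.** Sequential exchangeability: $A_t\perp\!\!\!\perp(S_{t+1}^{\bar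 a},\dots,S_T^{\bar a},Y^{\bar a})\mid\bar H_t$ for every $t$ and every treatment history $\bar a$ compatible with $\bar H_t$, where the superscript $\bar a$ denotes the counterfactual variables obtained by setting the treatments to $\bar a$ in the structural equations. Positivity at $(\bar h_t,a)$: $P(\bar H_t=\bar h_t,A_t=a)>0$. A cell relevant under $d$ is a pair $(\bar h_t,d_t(\bar h_t))$ with $\bar h_t$ reachable under $d$, i.e. $P^d(\bar H_t=\bar h_t)>0$; exchangeability at such a cell means the conditional independence given $\bar H_t=\bar h_t$. Conditional probabilities given null events are $0$ by convention. *)

(* Defs.v *)
From HB Require Import structures.
From mathcomp Require Import all_boot all_order all_algebra.
From mathcomp Require Import all_classical all_reals all_analysis.

Set Implicit Arguments.
Unset Strict Implicit.
Unset Printing Implicit Defensive.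

Import Order.TTheory GRing.Theory Num.Theory.
Import numFieldNormedType.Exports.

Local Open Scope classical_set_scope.
Local Open Scope ring_scope.

(* Families indexed by [nat] are only constrained at the times that occur in a
   problem with horizon [T]; their values at later indices play no role. *)

(* [hist X A t] is the set of sequences (x_0, a_0, x_1, ..., a_{t-1}, x_t). It
   serves both for covariate histories (X := L) and for trajectories of the
   state process (X := S, t := T). *)
Fixpoint hist (X : nat -> finType) (A : finType) (t : nat) : finType :=
  if t is t'.+1 then (hist X A t' * A * X t'.+1)%type else X 0%N.

Definition hlast (X : nat -> finType) (A : finType) (t : nat) :
    hist X A t -> X t :=
  match t with
  | 0 => fun h => h
  | t'.+1 => fun h : hist X A t' * A * X t'.+1 => h.2
  end.

Definition hext (X : nat -> finType) (A : finType) (t : nat)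
  (h : hist X A t) (a : A) (x : X t.+1) : hist X A t.+1 := (h, a, x).

(* The actions recorded in h are a_0, ..., a_{t-1}. *)
Fixpoint compatible (X : nat -> finType) (A : finType) (abar : nat -> A)
    (t : nat) : hist X A t -> bool :=
  match t with
  | 0 => fun _ => true
  | t'.+1 => fun h : hist X A t' * A * X t'.+1 =>
      compatible abar h.1.1 && (h.1.2 == abar t')
  end.

(* Structural causal models with state spaces S_t and action space A. The
   exogenous variables are random variables on a common sample space; they and
   the U_t may take values in arbitrary measurable spaces. [eS t] and [fS t]
   are the exogenous variable and the mechanism of S_{t+1}. *)
Record scm (R : realType) (T : nat) (S : nat -> finType) (A : finType) := Scm {
  dOm : measure_display;
  d0 : measure_display;
  dEU : nat -> measure_display;
  dEA : nat -> measure_display;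
  dES : nat -> measure_display;
  dU : nat -> measure_display;
  Om : measurableType dOm;
  Pr : probability Om R;
  E0 : measurableType d0;
  EU : forall t, measurableType (dEU t);
  EA : forall t, measurableType (dEA t);
  ES : forall t, measurableType (dES t);
  UU : forall t, measurableType (dU t);
  e0 : Om -> E0;
  eU : forall t, Om -> EU t;
  eA : forall t, Om -> EA t;
  eS : forall t, Om -> ES t;
  f0 : E0 -> S 0%N;
  fU : forall t, EU t -> UU t;
  fA : forall t, S t -> UU t -> EA t -> A;
  fS : forall t, S t -> A -> UU t -> ES t -> S t.+1;
  e0_measurable : measurable_fun [set: Om] e0;
  eU_measurable : forall t, (t < T)%N -> measurable_fun [set: Om] (@eU t);
  eA_measurable : forall t, (t < T)%N -> measurable_fun [set: Om] (@eA t);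
  eS_measurable : forall t, (t < T)%N -> measurable_fun [set: Om] (@eS t);
  f0_measurable : forall s, measurable [set e | f0 e = s];
  fU_measurable : forall t, (t < T)%N -> measurable_fun [set: EU t] (@fU t);
  fA_measurable : forall t s a, (t < T)%N ->
    measurable [set ue : UU t * EA t | fA s ue.1 ue.2 = a];
  fS_measurable : forall t s a s', (t < T)%N ->
    measurable [set ue : UU t * ES t | fS s a ue.1 ue.2 = s'];
  (* mutual independence; subfamilies are covered by taking B := setT *)
  exogenous_independent :
    forall (B0 : set E0) (BU : forall t, set (EU t))
           (BA : forall t, set (EA t)) (BS : forall t, set (ES t)),
    measurable B0 -> (forall t, measurable (BU t)) ->
    (forall t, measurable (BA t)) -> (forall t, measurable (BS t)) ->
    Pr [set w | B0 (e0 w) /\ forall t, (t < T)%N ->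
          [/\ BU t (eU t w), BA t (eA t w) & BS t (eS t w)]] =
    (Pr (e0 @^-1` B0) *
     \prod_(t < T) (Pr (eU t @^-1` BU t) * Pr (eA t @^-1` BA t) *
                    Pr (eS t @^-1` BS t)))%E
}.

Section Model.
Context (R : realType) (T : nat) (S : nat -> finType) (A : finType).
Variable M : scm R T S A.

Definition Uvar (t : nat) (w : Om M) : UU M t := fU (eU t w).

Definition pr (E : set (Om M)) : R := fine (Pr M E).

(* 0 when F is null, since x / 0 = 0 *)
Definition condpr (E F : set (Om M)) : R := pr (E `&` F) / pr F.

(* The state process when the equation for A_t is A_t = act t S_t w and all the
   other structural equations are those of M. *)
Fixpoint state (act : forall t, S t -> Om M -> A) (t : nat) (w : Om M) : S t :=
  match t with
  | 0 => f0 (e0 w)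
  | t'.+1 => let s := state act t' w in
             fS s (act t' s w) (Uvar t' w) (eS t' w)
  end.

Definition act_obs (t : nat) (s : S t) (w : Om M) : A :=
  fA s (Uvar t w) (eA t w).

Definition S_obs := state act_obs.
Definition A_obs (t : nat) (w : Om M) : A := act_obs (S_obs t w) w.

Definition S_regime (d : forall t, S t -> A) := state (fun t s _ => d t s).
Definition S_static (abar : nat -> A) := state (fun t _ _ => abar t).

Definition kernel (t : nat) (s : S t) (a : A) : S t.+1 -> R :=
  fun s' => pr [set w | fS s a (Uvar t w) (eS t w) = s'].
Definition root_kernel : S 0%N -> R := fun s => pr [set w | S_obs 0 w = s].

(* [Sn t s a] is the set of possible values of S_{t+1} after (s, a), and [G t]
   says that the bidirected edge A_t <-> S_{t+1} is present. *)
Definition meets_requirements (Sn : forall t, S t -> A -> {set S t.+1})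
    (G : pred nat) : Prop :=
  forall t, (t < T)%N ->
    (forall (s : S t) a (u : UU M t) (e : ES M t),
       fS s a u e \in Sn t s a) /\
    (~~ G t ->
       (forall (s : S t) (u u' : UU M t) (e : EA M t),
          fA s u e = fA s u' e) \/
       (forall (s : S t) a (u u' : UU M t) (e : ES M t),
          fS s a u e = fS s a u' e)).

(* V^d = E[Y^d] *)
Definition value (y : S T -> R) (d : forall t, S t -> A) : \bar R :=
  'E_(Pr M)[fun w => y (S_regime d T w)].

Definition reachable (d : forall t, S t -> A) (t : nat) (s : S t) : Prop :=
  0 < pr [set w | S_regime d t w = s].

End Model.

Section Feasible.
Context (R : realType).

Definition simplex (X : finType) (B : {set X}) : set (X -> R) :=
  [set q | [/\ forall x, 0 <= q x, \sum_x q x = 1 &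
               forall x, x \notin B -> q x = 0]].

Definition feasible_set (X : finType) (B : {set X}) (Q : set (X -> R)) :
    Prop :=
  [/\ Q !=set0,
      compact (Q : set {ptws X -> R}),
      convex_set (Q : set (X -> R^o)) &
      Q `<=` simplex B].

Context (T : nat) (S : nat -> finType) (A : finType).

(* A family Q of feasible transition sets: [Q0] is the root set, and [Q t] is
   the family of sets at time t >= 0. *)
Definition feasible_family (M : scm R T S A)
    (Sn : forall t, S t -> A -> {set S t.+1})
    (Q0 : set (S 0%N -> R))
    (Q : forall t, S t -> A -> set (S t.+1 -> R)) : Prop :=
  [/\ feasible_set finset.setT Q0, Q0 (root_kernel M) &
      forall t (s : S t) a, (t < T)%N ->
        feasible_set (Sn t s a) (Q t s a) /\ Q t s a (kernel M s a)].

(* q_{-1}(s_0) prod_{k<t} 1{a_k = d_k(s_k)} q_k(s_{k+1} | s_k, a_k) *)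
Fixpoint traj_law (d : forall t, S t -> A) (q0 : S 0%N -> R)
    (q : forall t, S t -> A -> S t.+1 -> R) (t : nat) : hist S A t -> R :=
  match t with
  | 0 => q0
  | t'.+1 => fun v : hist S A t' * A * S t'.+1 =>
      let: (v', a, s') := v in
      traj_law d q0 q v' * (a == d t' (hlast v'))%:R * q t' (hlast v') a s'
  end.

(* P^d(Q) *)
Definition traj_laws (d : forall t, S t -> A) (Q0 : set (S 0%N -> R))
    (Q : forall t, S t -> A -> set (S t.+1 -> R)) : set (hist S A T -> R) :=
  [set law | exists (q0 : S 0%N -> R) (q : forall t, S t -> A -> S t.+1 -> R),
     [/\ Q0 q0,
         forall t (s : S t), (t < T)%N -> Q t s (d t s) (q t s (d t s)) &
         law = traj_law d q0 q (t := T)]].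

Definition law_mean (y : S T -> R) (law : hist S A T -> R) : R :=
  \sum_v law v * y (hlast v).

Definition upper_bound y d Q0 Q : \bar R :=
  ereal_sup [set (law_mean y law)%:E | law in traj_laws d Q0 Q].
Definition lower_bound y d Q0 Q : \bar R :=
  ereal_inf [set (law_mean y law)%:E | law in traj_laws d Q0 Q].

End Feasible.

(* The full-history formulation: S_t = (L_0, A_0, L_1, ..., A_{t-1}, L_t). *)
Section FullHistory.
Context (R : realType) (T : nat) (L : nat -> finType) (A : finType).
Variable M : scm R T (hist L A) A.

Definition extensions_only
    (Sn : forall t, hist L A t -> A -> {set hist L A t.+1}) : Prop :=
  forall t (h : hist L A t) a, (t < T)%N ->
    (exists h', h' \in Sn t h a) /\
    forall h', h' \in Sn t h a -> exists l, h' = hext h a l.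

Definition L_obs (t : nat) (w : Om M) : L t := hlast (S_obs t w).

Definition cell (t : nat) (h : hist L A t) (a : A) : set (Om M) :=
  [set w | S_obs t w = h /\ A_obs t w = a].

(* P(L_0 = l) *)
Definition P_root (l : L 0%N) : R := pr [set w | L_obs 0 w = l].

(* P(L_{t+1} = l | H_t = h, A_t = a) *)
Definition P_next (t : nat) (h : hist L A t) (a : A) (l : L t.+1) : R :=
  condpr [set w | L_obs t.+1 w = l] (cell h a).

(* A distribution p of L_{t+1}, seen as a distribution on the histories that
   extend (h, a). *)
Definition as_state_law (t : nat) (h : hist L A t) (a : A) (p : L t.+1 -> R) :
    hist L A t.+1 -> R :=
  fun h' : hist L A t * A * L t.+1 => if h'.1 == (h, a) then p h'.2 else 0.

(* A_t _||_ (S_{t+1}^abar, ..., S_T^abar, Y^abar) given H_t = h, for every abar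
   compatible with h. All the variables are discrete, so that independence is
   factorization of the probabilities of atoms. *)
Definition exchangeable_at (y : hist L A T -> R) (t : nat) (h : hist L A t) :
    Prop :=
  forall abar : nat -> A, compatible abar h ->
  forall (a : A) (s : forall k, hist L A k) (r : R),
    let H := [set w | S_obs (M := M) t w = h] in
    let At := [set w | A_obs (M := M) t w = a] in
    let Future := [set w | (forall k, (t < k <= T)%N ->
                              S_static (M := M) abar k w = s k) /\
                           y (S_static abar T w) = r] in
    condpr (At `&` Future) H = condpr At H * condpr Future H.

Definition positive_at (t : nat) (h : hist L A t) (a : A) : Prop :=
  0 < pr (cell h a).

(* the sequences (l_0, ..., l_t) *)
Fixpoint covs (t : nat) : finType :=
  if t is t'.+1 then (covs t' * L t'.+1)%type else L 0%N.

(* the history with covariates l_0, ..., l_t and actions a_k = d_k(h_k) *)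
Fixpoint regime_hist (d : forall t, hist L A t -> A) (t : nat) :
    covs t -> hist L A t :=
  match t with
  | 0 => fun l => l
  | t'.+1 => fun l : covs t' * L t'.+1 =>
      let h := regime_hist d l.1 in hext h (d t' h) l.2
  end.

(* P(l_0) prod_{k<t} P(l_{k+1} | (l_0, ..., l_k), (a_0, ..., a_k)) *)
Fixpoint g_weight (d : forall t, hist L A t -> A) (t : nat) : covs t -> R :=
  match t with
  | 0 => fun l => P_root l
  | t'.+1 => fun l : covs t' * L t'.+1 =>
      let h := regime_hist d l.1 in g_weight d l.1 * P_next h (d t' h) l.2
  end.

End FullHistory.

(* Main.v *)
(* Since a history contains its past, the event that the regime produces a full
   history h_T equals the event that the static treatments read off h_T do.
   Exchangeability and consistency move this event from conditioning on H_t to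
   conditioning on H_{t+1}, one factor P(l_{t+1} | h_t, a_t) at a time; this
   identifies P^d without using independence of the exogenous variables.
   Histories that d cannot reach have weight 0, because H_t = h_t forces the
   regime to produce h_t as well. Hence the feasible sets at unreachable
   histories do not affect the mean, and every law in P^d(Q) has the mean given
   by the g-formula. Such a law exists, since the true kernels are feasible. *)

Require Import Defs.
From HB Require Import structures.
From mathcomp Require Import all_boot all_order all_algebra.
From mathcomp Require Import all_classical all_reals all_analysis.

Set Implicit Arguments.
Unset Strict Implicit.
Unset Printing Implicit Defensive.

Import Order.TTheory GRing.Theory Num.Theory.

Local Open Scope classical_set_scope.
Local Open Scope ring_scope.

(** * Probabilities and measurability of events of the state process *)

Section Probability.
Context (R : realType) (T : nat) (S : nat -> finType) (A : finType).
Context (M : scm R T S A).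

Lemma pr_ge0 (E : set (Om M)) : 0 <= pr E.
Proof. exact/fine_ge0/measure_ge0. Qed.

Lemma pr_le (E F : set (Om M)) :
  measurable E -> measurable F -> E `<=` F -> pr E <= pr F.
Proof.
move=> mE mF EF; apply: fine_le; rewrite ?fin_num_measure//.
by apply: le_measure => //; rewrite inE.
Qed.

Lemma pr_eq0 (E F : set (Om M)) :
  measurable E -> measurable F -> E `<=` F -> pr F = 0 -> pr E = 0.
Proof.
by move=> mE mF EF F0; apply/le_anti; rewrite pr_ge0 andbT -F0 pr_le.
Qed.

Lemma measurable_Uvar t : (t < T)%N -> measurable_fun setT (@Uvar _ _ _ _ M t).
Proof.
move=> tT; apply: measurableT_comp; first exact: fU_measurable.
exact: eU_measurable.
Qed.

Lemma measurable_act_obs t (s : S t) a :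
  (t < T)%N -> measurable [set w : Om M | act_obs s w = a].
Proof.
move=> tT.
have mp := measurable_fun_pair (measurable_Uvar tT) (eA_measurable (s0:=M) tT).
by have := mp measurableT _ (fA_measurable s a tT); rewrite setTI.
Qed.

(** Mechanisms are measurable only at fixed arguments, so the event is split over the finitely many
    values of the previous state and action. *)
Lemma measurable_state (act : forall t, S t -> Om M -> A) :
  (forall t s a, (t < T)%N -> measurable [set w | act t s w = a]) ->
  forall t s, (t <= T)%N -> measurable [set w | state act t w = s].
Proof.
move=> mact; elim=> [|t IH] s tT /=.
  have := e0_measurable measurableT (@f0_measurable _ _ _ _ M s).
  by rewrite setTI.
have -> : [set w | fS (state act t w) (act t (state act t w) w)
              (Uvar t w) (eS t w) = s] =
    \bigcup_(p in [set: S t * A]) ([set w | state act t w = p.1] `&`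
       [set w | act t p.1 w = p.2] `&`
       [set w | fS p.1 p.2 (Uvar t w) (eS t w) = s]).
  apply/seteqP; split=> [w /= ws|w [[s' a] _ /= [[<- <-] //]]].
  by exists (state act t w, act t (state act t w) w).
apply: fin_bigcup_measurable => [|[s' a] _]; first exact: finite_finset.
apply: measurableI; first by apply: measurableI; [exact/IH/ltnW|exact: mact].
have mp := measurable_fun_pair (measurable_Uvar tT) (eS_measurable (s0:=M) tT).
by have := mp measurableT _ (fS_measurable s' a s tT); rewrite setTI.
Qed.

Lemma measurable_cst_act (f : forall t, S t -> A) t s a :
  measurable [set w : Om M | f t s = a].
Proof.
have [fa|fa] := eqVneq (f t s) a.
  by rewrite (_ : mkset _ = setT)// -subTset.
by rewrite (_ : mkset _ = set0)// -subset0 => w /eqP; rewrite (negbTE fa).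
Qed.

Lemma measurable_S_obs t s :
  (t <= T)%N -> measurable [set w : Om M | S_obs t w = s].
Proof. by apply: measurable_state => *; exact: measurable_act_obs. Qed.

Lemma measurable_S_regime d t s :
  (t <= T)%N -> measurable [set w : Om M | S_regime d t w = s].
Proof. by apply: measurable_state => *; exact: measurable_cst_act. Qed.

Lemma measurable_S_static abar t s :
  (t <= T)%N -> measurable [set w : Om M | S_static abar t w = s].
Proof. exact: (measurable_S_regime (fun t _ => abar t)). Qed.

End Probability.

(** * Covariate sequences and the histories they generate *)

Section Covariates.
Context (L : nat -> finType) (A : finType).

(** One infinite path yields its prefixes of all lengths, which an element of [covs L t] does not do
    directly. *)
Fixpoint truncate (l : forall k, L k) (t : nat) : covs L t :=
  match t with
  | 0 => l 0%N
  | t'.+1 => (truncate l t', l t'.+1)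
  end.

Lemma eq_truncate (l l' : forall k, L k) t :
  (forall k, (k <= t)%N -> l k = l' k) -> truncate l t = truncate l' t.
Proof.
elim: t => [|t IH] ll' /=; first exact: ll'.
by rewrite IH ?ll'// => k kt; rewrite ll'// ltnW.
Qed.

Lemma truncate_surj (l0 : forall k, L k) t (c : covs L t) :
  exists l, truncate l t = c.
Proof.
elim: t c => [|t IH] c.
  by exists (eqtype.dfwith l0 (c : L 0%N)); rewrite /= eqtype.dfwith_in.
case: c => c x; have [l lc] := IH c.
exists (eqtype.dfwith l x); rewrite /= eqtype.dfwith_in -lc; congr pair.
by apply: eq_truncate => k kt; rewrite eqtype.dfwith_out// gtn_eqF.
Qed.

Lemma sum_hist_recr (R : nmodType) t (F : hist L A t.+1 -> R) :
  \sum_v F v =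
  \sum_(h : hist L A t) \sum_(a : A) \sum_(x : L t.+1) F (hext h a x).
Proof.
rewrite (pair_bigA _ (fun h a => \sum_x F (hext h a x))).
rewrite (pair_bigA _ (fun ha x => F (hext ha.1 ha.2 x))).
by apply: eq_bigr => -[[h a] x].
Qed.

Lemma sum_covs_recr (R : nmodType) t (F : covs L t.+1 -> R) :
  \sum_c F c = \sum_(c : covs L t) \sum_(x : L t.+1) F (c, x).
Proof.
rewrite (pair_bigA _ (fun c x => F ((c, x) : covs L t.+1))).
by apply: eq_bigr => -[c x].
Qed.

Lemma regime_hist_inj (d : forall t, hist L A t -> A) t :
  injective (@regime_hist L A d t).
Proof.
elim: t => [//|t IH] [c x] [c' x'] /= [].
by move=> /IH -> _ ->.
Qed.

(** This lets exchangeability be applied to the static treatments read off a path of [d]. *)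
Lemma regime_compatible (d : forall t, hist L A t -> A) l t :
  compatible (fun k => d k (regime_hist d (truncate l k)))
    (regime_hist d (truncate l t)).
Proof. by elim: t => [//|t IH] /=; rewrite IH eqxx. Qed.

End Covariates.

(** * Histories as states: nesting, consistency and null weights *)

Section FullHistory.
Context (R : realType) (T : nat) (L : nat -> finType) (A : finType).
Context (M : scm R T (hist L A) A).
Context (Sn : forall t, hist L A t -> A -> {set hist L A t.+1}).
Context (Sn_ext : extensions_only T Sn).
Context (fS_Sn : forall t (s : hist L A t) a (u : UU M t) (e : ES M t),
  (t < T)%N -> fS s a u e \in Sn s a).
Implicit Types (w : Om M) (act : forall t, hist L A t -> Om M -> A).
Implicit Types (d : forall t, hist L A t -> A).

(** The next state lies in [Sn], which contains only extensions. With [act] arbitrary, this covers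
    the observed, regime and static processes at once. *)
Lemma state_hext act t w : (t < T)%N ->
  exists l, state act t.+1 w = hext (state act t w) (act t (state act t w) w) l.
Proof.
move=> tT; have [_] := Sn_ext (state act t w) (act t (state act t w) w) tT.
by apply; exact: fS_Sn.
Qed.

Lemma state_hextP act t w h a l : (t < T)%N -> state act t.+1 w = hext h a l ->
  state act t w = h /\ act t h w = a.
Proof.
move=> tT; have [l' ->] := state_hext act w tT.
by case=> -> <- _.
Qed.

(** Identifies the numerator of [P_next] as the probability of one longer observed history. *)
Lemma obs_next t (h : hist L A t) a l : (t < T)%N ->
  [set w : Om M | L_obs t.+1 w = l] `&` cell h a =
  [set w | S_obs t.+1 w = hext h a l].
Proof.
move=> tT; apply/seteqP; split=> w.
  rewrite /L_obs /cell /A_obs /S_obs /= -/(state _ t.+1 w) => -[+ [Sh Aa]].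
  have [l' ->] := state_hext (@act_obs _ _ _ _ M) w tT.
  by rewrite Aa Sh => <-.
rewrite /L_obs /A_obs /S_obs /mkset => Sw; have [Sh Aa] := state_hextP tT Sw.
split; first by rewrite /mkset /L_obs /S_obs Sw.
by split=> //; rewrite /A_obs /S_obs Sh.
Qed.

(** Consistency: the history records actions that agree with [d], so both processes evaluate the
    same mechanisms at the same exogenous values. *)
Lemma regime_of_state act d t (c : covs L t) w : (t <= T)%N ->
  state act t w = regime_hist d c -> S_regime d t w = regime_hist d c.
Proof.
elim: t c => [//|t IH] [c l] tT Sw /=.
have [Sh Aa] := state_hextP tT Sw.
rewrite /S_regime /= -/(S_regime d t w) (IH c (ltnW tT) Sh).
by move: Sw => /=; rewrite Sh Aa.
Qed.

Lemma measurable_cell t (h : hist L A t) a :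
  (t < T)%N -> measurable (cell h a : set (Om M)).
Proof.
move=> tT; have -> : cell h a =
    [set w : Om M | S_obs t w = h] `&` [set w | act_obs h w = a].
  by apply/seteqP; split=> w [/= Sh Aa]; split=> //=; move: Aa; rewrite /A_obs Sh.
apply: measurableI; first exact/measurable_S_obs/ltnW.
exact: measurable_act_obs.
Qed.

(** This probability is the numerator of the last factor; at time 0 it is the weight itself. *)
Lemma g_weight_null d t (c : covs L t) : (t <= T)%N ->
  pr [set w : Om M | S_obs t w = regime_hist d c] = 0 -> g_weight M d c = 0.
Proof.
case: t c => [//|t] [c l] tT /= c0.
by rewrite /P_next /condpr (obs_next _ _ _ tT) c0 mul0r mulr0.
Qed.

Lemma g_weight_unreachable d t (c : covs L t) : (t <= T)%N ->
  ~ reachable M d (regime_hist d c) -> g_weight M d c = 0.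
Proof.
move=> tT nr; apply: g_weight_null => //.
apply: (pr_eq0 (F := [set w | S_regime d t w = regime_hist d c])).
- exact: measurable_S_obs.
- exact: measurable_S_regime.
- by move=> w /=; apply: regime_of_state.
- by apply/eqP; rewrite eq_le pr_ge0 andbT leNgt; apply/negP.
Qed.

(** * Identification of the law under the regime *)

Section GFormula.
Context (y : hist L A T -> R) (d : forall t, hist L A t -> A).
Context (exch : forall t (h : hist L A t), (t < T)%N -> reachable M d h ->
  exchangeable_at M y h).
Context (pos : forall t (h : hist L A t), (t < T)%N -> reachable M d h ->
  positive_at M h (d h)).

Section Path.
Context (l : forall k, L k).
(** One path of [d] is fixed; [abar] is the static treatment it records, and [F] is the event that
    this treatment reproduces the whole path. *)
Let s k : hist L A k := regime_hist d (truncate l k).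
Let abar k : A := d (s k).
Let F := [set w : Om M | S_static abar T w = s T].
Let H t := [set w : Om M | S_obs t w = s t].

Lemma state_prefix act k n w : (k <= n <= T)%N ->
  state act n w = s n -> state act k w = s k.
Proof.
elim: n => [|n IH]; first by rewrite leqn0 => /andP[/eqP ->].
rewrite leq_eqVlt => /andP[/predU1P[-> //|kn] nT] Sw.
apply: IH; first by rewrite -ltnS kn ltnW.
by have [] := state_hextP nT Sw.
Qed.

Lemma static_of_state act n w : (n <= T)%N ->
  state act n w = s n -> S_static abar n w = s n.
Proof.
elim: n => [//|n IH] nT Sw; have [Sh Aa] := state_hextP nT Sw.
rewrite /S_static /= -/(S_static abar n w) (IH (ltnW nT) Sh).
by move: Sw => /=; rewrite Sh Aa.
Qed.

(** The terminal history determines both the earlier states and the outcome, so the atom of the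
    future in exchangeability collapses to [F]. *)
Lemma static_future t (r := y (s T)) : (t < T)%N ->
  [set w | (forall k, (t < k <= T)%N -> S_static (M := M) abar k w = s k) /\
           y (S_static abar T w) = r] = F.
Proof.
move=> tT; apply/seteqP; split=> w /=; first by case=> + _; apply; rewrite tT /=.
move=> Fw; split; last by rewrite Fw.
by move=> k /andP[_ kT]; apply: state_prefix Fw; rewrite kT /=.
Qed.

(** Consistency: on the left, observed and static states agree at [t] and get the same action, so
    they agree at [t.+1]. Conversely, the history at [t.+1] contains the past state and action. *)
Lemma future_step t : (t < T)%N ->
  [set w : Om M | A_obs t w = abar t] `&` F `&` H t = F `&` H t.+1.
Proof.
move=> tT; apply/seteqP; split=> w /=.
  rewrite /H/= /A_obs => -[[Aa Fw] Sh]; split=> //.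
  have Sw : S_static abar t w = s t.
    by apply: state_prefix Fw; rewrite (ltnW tT) /=.
  have : S_static abar t.+1 w = s t.+1.
    by apply: state_prefix Fw; rewrite tT /=.
  by rewrite /S_obs /S_static /= -/(S_static abar t w) Sw -/(S_obs t w) Aa Sh.
rewrite /H/= /A_obs => -[Fw Sw]; have [Sh Aa] := state_hextP tT Sw.
by rewrite /S_obs Sh.
Qed.

Lemma static_regime :
  F = [set w | S_regime d T w = s T].
Proof.
apply/seteqP; split=> w /= Sw; first exact: regime_of_state Sw.
exact: static_of_state Sw.
Qed.

(* The conditional probability is 1 at t = T if [H T] has positive probability;
   if [H T] is null it is 0 by convention, and so is the weight. *)
Lemma g_formula_step t : (t <= T)%N ->
  pr F = g_weight M d (truncate l t) * condpr F (H t).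
Proof.
have mF : measurable F by exact: measurable_S_static.
have mH k : (k <= T)%N -> measurable (H k) by move=> kT; exact: measurable_S_obs.
have null (k : nat) : (k <= T)%N -> pr (H k) = 0 -> pr (F `&` H k) = 0.
  move=> kT; apply: pr_eq0; [exact: measurableI (mH _ _)|exact: mH|].
  exact: subIsetr.
elim: t => [|t IH] tT.
  (* The initial state is the same for all treatments, so [F] already fixes it. *)
  have FH : F `&` H 0%N = F.
    apply: setIidl => w Fw.
    exact: (@state_prefix (fun k _ _ => abar k) 0%N T w (leqnn T) Fw).
  rewrite /condpr FH /= -[P_root _ _]/(pr (H 0%N)).
  have [H0|H0] := eqVneq (pr (H 0%N)) 0; last by rewrite mulrC divfK.
  by rewrite -FH null// !mul0r mulr0.
(* Exchangeability and positivity are available only at reachable histories; after an unreachable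
   prefix both sides vanish. *)
have [rt|nrt] := pselect (reachable M d (s t)); last first.
  rewrite [g_weight _ _ _]/= g_weight_unreachable ?mul0r ?(ltnW tT)//.
  apply: (pr_eq0 (F := [set w : Om M | S_regime d t w = s t])) => //.
  - exact/measurable_S_regime/ltnW.
  - rewrite static_regime => w; apply: state_prefix.
    by rewrite (ltnW tT) /=.
  - by apply/eqP; rewrite eq_le pr_ge0 andbT leNgt; apply/negP.
have := exch tT rt (regime_compatible d l t) (abar t) s (y (s T)).
rewrite /= (static_future tT) /condpr (future_step tT).
have -> : [set w : Om M | A_obs t w = abar t] `&` [set w | S_obs t w = s t] =
    cell (s t) (abar t) by rewrite setIC.
rewrite -/(H t) => ex.
have C0 : 0 < pr (cell (s t) (abar t) : set (Om M)) := pos tT rt.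
have H0 : 0 < pr (H t).
  apply: lt_le_trans C0 _; apply: pr_le; [exact: measurable_cell|exact/mH/ltnW|].
  by move=> w [].
rewrite (IH (ltnW tT)) /= /P_next /condpr (obs_next _ _ _ tT).
rewrite -/(s t) -/(abar t) -[[set w | _ = hext _ _ _]]/(H t.+1) -mulrA.
congr (_ * _).
(* Exchangeability adds the event that the action is [abar t] to the conditioning; [future_step] has
   already rewritten the joint event. *)
have -> : pr (F `&` H t) / pr (H t) =
    pr (F `&` H t.+1) / pr (cell (s t) (abar t) : set (Om M)).
  rewrite -[pr (F `&` H t.+1)](divfK (lt0r_neq0 H0)) ex [_ * pr (H t)]mulrAC.
  by rewrite divfK ?gt_eqF// [RHS]mulrAC divff ?gt_eqF// mul1r.
have [H1|H1] := eqVneq (pr (H t.+1)) 0; first by rewrite null// H1 !mul0r.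
by rewrite [RHS]mulrC mulrA divfK.
Qed.

Lemma pr_regime_path :
  pr [set w : Om M | S_regime d T w = s T] = g_weight M d (truncate l T).
Proof.
rewrite -static_regime (g_formula_step (leqnn T)) /condpr.
have -> : F `&` H T = H T.
  by apply: setIidr => w; exact: static_of_state.
have [H0|H0] := eqVneq (pr (H T)) 0; last by rewrite divff ?mulr1.
by rewrite (g_weight_null _ H0) // mul0r.
Qed.

End Path.

Lemma g_formula (c : covs L T) :
  pr [set w : Om M | S_regime d T w = regime_hist d c] = g_weight M d c.
Proof.
(* An infinite path needs an element of every [L k]; the observed process at an arbitrary sample
   point supplies them. *)
have [l <-] := truncate_surj (fun k => hlast (S_obs k (point : Om M))) c.
exact: pr_regime_path.
Qed.

Lemma regime_hist_onto t w : (t <= T)%N ->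
  exists c : covs L t, S_regime d t w = regime_hist d c.
Proof.
elim: t => [|t IH] tT; first by exists (S_regime d 0%N w).
have [c Sc] := IH (ltnW tT).
have [l Sl] := state_hext (fun t s _ => d s) w tT.
by exists (c, l); rewrite [LHS]Sl /= -/(S_regime d t w) Sc.
Qed.

Lemma value_g_formula :
  value M y d = (\sum_(c : covs L T) y (regime_hist d c) * g_weight M d c)%:E.
Proof.
pose E c := [set w : Om M | S_regime d T w = regime_hist d c].
have mE c : measurable (E c) by exact: measurable_S_regime.
rewrite /value unlock.
under eq_integral => w _.
  (* The events [E c] partition the sample space, by surjectivity and injectivity of
     [regime_hist]. *)
  have -> : y (S_regime d T w) = \sum_c y (regime_hist d c) * \1_(E c) w.
    have [c Sc] := regime_hist_onto w (leqnn T).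
    rewrite (bigD1 c)//= big1 ?addr0 => [|c' c'c].
      by rewrite indicE mem_set ?mulr1 ?Sc.
    rewrite indicE memNset ?mulr0// /E /mkset Sc => /regime_hist_inj cc'.
    by rewrite cc' eqxx in c'c.
  rewrite -sumEFin; over.
rewrite integral_sum//; last first.
  move=> c; under eq_fun do rewrite EFinM.
  by apply: integrableZl => //; exact: integrable_indic.
rewrite -sumEFin; apply: eq_bigr => c _.
under eq_integral do rewrite EFinM.
rewrite integralZl//; last exact: integrable_indic.
rewrite integral_indic// setIT EFinM -g_formula /pr fineK// fin_num_measure//.
exact: mE.
Qed.

End GFormula.

(** * Means under feasible trajectory laws *)

Lemma traj_law_sum d (q0 : L 0%N -> R)
    (q : forall t, hist L A t -> A -> hist L A t.+1 -> R) :
  q0 = P_root M ->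
  (forall t (h : hist L A t), (t < T)%N -> reachable M d h ->
     q t h (d t h) = as_state_law h (d t h) (P_next M h (d t h))) ->
  forall t (f : hist L A t -> R), (t <= T)%N ->
  \sum_v traj_law d q0 q v * f (hlast v) =
  \sum_(c : covs L t) f (regime_hist d c) * g_weight M d c.
Proof.
move=> -> qE; elim=> [|t IH] f tT.
  by apply: eq_bigr => c _; rewrite mulrC.
(* The last transition is averaged out into a new function of the state at [t], which is why the
   induction runs over all [f]. *)
transitivity (\sum_(v : hist (hist L A) A t) traj_law d (P_root M) q v *
    \sum_h q t (hlast v) (d t (hlast v)) h * f h).
  rewrite sum_hist_recr.
  apply: eq_bigr => v _; rewrite (bigD1 (d t (hlast v)))//= [X in _ + X]big1.
    rewrite addr0 mulr_sumr; apply: eq_bigr => h _.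
    by rewrite eqxx mulr1 mulrA.
  move=> a ad; apply: big1 => h _.
  by rewrite (negbTE ad) mulr0 !mul0r.
rewrite (IH (fun h => \sum_h' q t h (d t h) h' * f h') (ltnW tT)).
rewrite sum_covs_recr.
apply: eq_bigr => c _; set h := regime_hist d c.
have [rh|nrh] := pselect (reachable M d h); last first.
  rewrite (g_weight_unreachable (ltnW tT) nrh) mulr0 big1// => x _.
  by rewrite /= (g_weight_unreachable (ltnW tT) nrh) mul0r mulr0.
(* [as_state_law] is supported on extensions of [h] by the action of [d], so only the sum over the
   new covariate survives. *)
rewrite (qE _ _ tT rh) sum_hist_recr (bigD1 h)//= [X in _ + X]big1 => [|h' h'h].
  rewrite addr0 (bigD1 (d t h))//= [X in _ + X]big1 => [|a ad].
    rewrite addr0 mulr_suml; apply: eq_bigr => x _.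
    by rewrite /as_state_law /= eqxx -/h -mulrA mulrC -mulrA.
  apply: big1 => x _.
  by rewrite /as_state_law /= xpair_eqE (negbTE ad) andbF mul0r.
apply: big1 => a _; apply: big1 => x _.
by rewrite /as_state_law /= xpair_eqE (negbTE h'h) mul0r.
Qed.

End FullHistory.

(** * Collapse of the bounds to the g-formula *)

Theorem corollary4p6 (R : realType) (T : nat) (L : nat -> finType)
  (A : finType) (M : scm R T (hist L A) A)
  (Sn : forall t, hist L A t -> A -> {set hist L A t.+1}) (G : pred nat)
  (y : hist L A T -> R) (d : forall t, hist L A t -> A)
  (Q0 : set (hist L A 0%N -> R))
  (Q : forall t, hist L A t -> A -> set (hist L A t.+1 -> R))
  (T_ge1 : (1 <= T)%N)
  (Sn_ext : extensions_only T Sn)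
  (M_ok : meets_requirements M Sn G)
  (Q_feasible : feasible_family M Sn Q0 Q)
  (exch : forall t (h : hist L A t), (t < T)%N -> reachable M d h ->
     exchangeable_at M y h)
  (pos : forall t (h : hist L A t), (t < T)%N -> reachable M d h ->
     positive_at M h (d t h))
  (Q_singleton : forall t (h : hist L A t), (t < T)%N -> reachable M d h ->
     Q t h (d t h) = [set as_state_law h (d t h) (P_next M h (d t h))])
  (Q0_default : Q0 = [set (P_root M : hist L A 0%N -> R)]) :
  [/\ upper_bound y d Q0 Q = lower_bound y d Q0 Q,
      lower_bound y d Q0 Q = value M y d &
      value M y d =
        (\sum_(l : covs L T) y (regime_hist d l) * g_weight M d l)%:E].
Proof.
have fS_Sn t (s : hist L A t) a (u : UU M t) (e : ES M t) :
    (t < T)%N -> fS s a u e \in Sn t s a by move=> /M_ok[+ _]; apply.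
set g := \sum_(l : covs L T) _.
have valueE : value M y d = g%:E by exact: (value_g_formula Sn_ext fS_Sn).
have [_ Q0root Qker] := Q_feasible.
(* Nonemptiness matters as much as uniqueness here: over an empty set the supremum and infimum would
   be infinite. *)
have laws : [set (law_mean y law)%:E | law in traj_laws d Q0 Q] = [set g%:E].
  apply/seteqP; split=> [_ [_ [q0 [q [Q0q0 Qq ->]]] <-]|_ ->] /=.
    rewrite /law_mean (traj_law_sum Sn_ext fS_Sn)//.
      by move: Q0q0; rewrite Q0_default.
    by move=> t h tT rh; have := Qq t h tT; rewrite Q_singleton.
  exists (traj_law d (root_kernel M) (@Defs.kernel _ _ _ _ M) (t:=T)).
    exists (root_kernel M), (@Defs.kernel _ _ _ _ M); split=> //.
    by move=> t h tT; have [] := Qker t h (d t h) tT.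
  rewrite /law_mean (traj_law_sum Sn_ext fS_Sn)// => t h tT rh.
  (* Belonging to a singleton set forces the true kernel to equal the observational conditional law
     at reachable histories. *)
  by have [_] := Qker t h (d t h) tT; rewrite Q_singleton.
rewrite /upper_bound /lower_bound laws ereal_sup1 ereal_inf1 valueE.
by split.
Qed.
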